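(* Fix $N\ge 1$, $\alpha>0$, $\beta>0$, $\gamma\in\mathbb{R}$, $c\ge 0$, service rates $\mu_1,\dots,\mu_N>0$, and $\lambda>0$ with $\lambda<\Lambda:=\sum_{i=1}^N\mu_i$. Then the reflected ODE on $\mathbb{R}_+^N$ associated with the Reflected UAS routing law has a unique equilibrium $q^*$, namely $$q_i^*=\max\!\left\{0,\ \frac{\mu_i^\beta}{\alpha}\log\!\left(\frac{\theta_i}{K^*}\right)\right\},\qquad i=1,\dots,N,$$ where $\theta_i:=\mu_i^{\gamma-1}\exp(-\alpha c/\mu_i^\beta)$ and $K^*>0$ is the unique solution of $\lambda=\sum_{i=1}^N\min\{\mu_i,\mu_i\theta_i/K\}$ in $K>0$; and every reflected trajectory $q:[0,\infty)\to\mathbb{R}_+^N$ satisfies $$\lim_{t\to\infty}q(t)=q^*.$$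
   Context: Here $\mathbb{R}_+^N=[0,\infty)^N$. The routing law is $p_i(q)=w_i(q)/\sum_{j=1}^N w_j(q)$ with $w_i(q)=\mu_i^\gamma\exp(-\alpha(q_i+c)/\mu_i^\beta)$. The unconstrained drift is $F_i(q)=\lambda p_i(q)-\mu_i$. A reflected trajectory is a continuous function $q:[0,\infty)\to\mathbb{R}_+^N$ (with arbitrary initial point $q(0)\in\mathbb{R}_+^N$) for which there are continuous nondecreasing functions $y_i:[0,\infty)\to\mathbb{R}$ with $y_i(0)=0$, $q_i(t)=q_i(0)+\int_0^tF_i(q(s))\,ds+y_i(t)$ for all $t\ge 0$, and $\int_0^\infty q_i(s)\,dy_i(s)=0$, for $i=1,\dots,N$. In coordinates this is $\dot q_i=\Gamma_i(q)$ for almost every $t$, where $\Gamma_i(q)=F_i(q)$ if $q_i>0$ and $\Gamma_i(q)=\max\{F_i(q),0\}$ if $q_i=0$. An equilibrium is a point $q^*\in\mathbb{R}_+^N$ with $\Gamma_i(q^* )=0$ for all $i$; equivalently, $q_i^*\ge 0$, $\lambda p_i(q^* )\le\mu_i$ and $q_i^*(\mu_i-\lambda p_i(q^* ))=0$ for all $i$. *)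

(* Defs.v *)
From HB Require Import structures.
From mathcomp Require Import all_boot all_order all_algebra.
From mathcomp Require Import all_classical all_reals all_analysis.

Set Implicit Arguments.
Unset Strict Implicit.
Unset Printing Implicit Defensive.

Import Order.TTheory GRing.Theory Num.Theory.
Import numFieldNormedType.Exports.

Local Open Scope classical_set_scope.
Local Open Scope ring_scope.

Definition orthant (R : realType) (N : nat) : set 'rV[R]_N :=
  [set q | forall i, 0 <= q 0 i].

Definition weight (R : realType) (N : nat) (alpha beta gamma c : R)
    (mu : 'I_N -> R) (q : 'rV[R]_N) (i : 'I_N) : R :=
  mu i `^ gamma * expR (- (alpha * (q 0 i + c) / mu i `^ beta)).

Definition routing (R : realType) (N : nat) (alpha beta gamma c : R)
    (mu : 'I_N -> R) (q : 'rV[R]_N) (i : 'I_N) : R :=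
  weight alpha beta gamma c mu q i / \sum_j weight alpha beta gamma c mu q j.

Definition drift (R : realType) (N : nat) (alpha beta gamma c : R)
    (mu : 'I_N -> R) (lambda : R) (q : 'rV[R]_N) (i : 'I_N) : R :=
  lambda * routing alpha beta gamma c mu q i - mu i.

Definition reflected_drift (R : realType) (N : nat) (alpha beta gamma c : R)
    (mu : 'I_N -> R) (lambda : R) (q : 'rV[R]_N) (i : 'I_N) : R :=
  if 0 < q 0 i then drift alpha beta gamma c mu lambda q i
  else Num.max (drift alpha beta gamma c mu lambda q i) 0.

Definition equilibrium (R : realType) (N : nat) (alpha beta gamma c : R)
    (mu : 'I_N -> R) (lambda : R) (q : 'rV[R]_N) : Prop :=
  orthant q /\
  forall i, reflected_drift alpha beta gamma c mu lambda q i = 0.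

(* Only the values of [q] on [0, +oo[ matter. A continuous nondecreasing
   regulator on [0, +oo[ that starts at 0 is represented by its extension by 0
   to the whole line, which is continuous and nondecreasing there; the integral
   of q_i dy_i is taken against the Lebesgue-Stieltjes measure of that
   extension (which has no mass on ]-oo, 0]), as an extended real. *)
Definition reflected_trajectory (R : realType) (N : nat)
    (alpha beta gamma c : R) (mu : 'I_N -> R) (lambda : R)
    (q : R -> 'rV[R]_N) : Prop :=
  [/\ {within `[0, +oo[, continuous q},
      forall t, 0 <= t -> orthant (q t) &
      exists y : 'I_N -> cumulative R R, forall i,
        [/\ continuous (y i),
            forall t, t <= 0 -> y i t = 0,
            forall t, 0 <= t ->
              q t 0 i = q 0 0 i
                + \int[lebesgue_measure]_(s in `[0, t])
                    drift alpha beta gamma c mu lambda (q s) i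
                + y i t &
            (\int[lebesgue_stieltjes_measure (y i)]_(s in `[0%R, +oo[)
               (q s 0%R i)%:E = 0)%E]].

Definition theta (R : realType) (N : nat) (alpha beta gamma c : R)
    (mu : 'I_N -> R) (i : 'I_N) : R :=
  mu i `^ (gamma - 1) * expR (- (alpha * c / mu i `^ beta)).

Definition balance (R : realType) (N : nat) (alpha beta gamma c : R)
    (mu : 'I_N -> R) (lambda K : R) : Prop :=
  lambda =
  \sum_i Num.min (mu i) (mu i * theta alpha beta gamma c mu i / K).

Definition qstar (R : realType) (N : nat) (alpha beta gamma c : R)
    (mu : 'I_N -> R) (K : R) : 'rV[R]_N :=
  \row_i Num.max 0
    (mu i `^ beta / alpha * ln (theta alpha beta gamma c mu i / K)).

(* Main.v *)
(* Put [a_i = alpha / mu_i ^ beta]. Since [log w_i] is affine in [q_i] with slope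
   [- a_i], the unconstrained field is a gradient flow, in the metric
   [diag (a_i)], of the convex function [lambda log (sum_j w_j) + sum_i a_i mu_i q_i].
   Hence [E(q) = sum_i a_i (q_i - q*_i)^2] is a Lyapunov function: its dissipation
   [D(q) = sum_i a_i (q_i - q*_i) F_i(q)] is nonpositive on the orthant and
   vanishes only at [q*] (strictness along the flat direction [1 / a_i] of the
   log-sum-exp uses [lambda < sum_i mu_i]); this also gives uniqueness of the
   equilibrium.
   Along a reflected trajectory each coordinate is Lipschitz and its regulator
   moves only while the coordinate is small, so over a step [u] the reflection
   costs [O(u ^ 2)]: [E(q(s + u)) <= E(q(s)) + u (2 D(q(s)) + o(1))], with [o(1)]
   uniform on sublevel sets of [E]. By compactness [D] is bounded away from 0
   where [E >= rho], so sampling on a fine time grid drives [E] below [2 rho]. *)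
Require Import Defs.
From HB Require Import structures.
From mathcomp Require Import all_boot all_order all_algebra.
From mathcomp Require Import all_classical all_reals all_analysis.
From mathcomp Require Import measurable_realfun ring lra.

Set Implicit Arguments.
Unset Strict Implicit.
Unset Printing Implicit Defensive.

Import Order.TTheory GRing.Theory Num.Theory.
Import numFieldNormedType.Exports.

Local Open Scope classical_set_scope.
Local Open Scope ring_scope.

(** * Stieltjes and Lebesgue integrals over intervals *)

(** On the segment [f] is at least its positive minimum [f r], so [f r] times the mass of []s, t]]
    is at most the vanishing integral. This turns complementarity into a pointwise rule: the
    regulator is frozen while the queue is positive. *)
Lemma stieltjes_constant (R : realType) (y : cumulative R R) (f : R -> R)
    (s t : R) :
  continuous f -> (forall u, 0 <= u -> 0 <= f u) ->
  (\int[lebesgue_stieltjes_measure y]_(u in `[0%R, +oo[) (f u)%:E = 0)%E ->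
  0 <= s -> s <= t -> (forall u, s <= u -> u <= t -> 0 < f u) -> y s = y t.
Proof.
move=> cf f0 int0 s0 st fst0.
have [r] := EVT_min st (continuous_subspaceT cf).
rewrite in_itv/= => /andP[sr rt] fr.
have fr0 := fst0 _ sr rt.
(* Half-open on the left: the Stieltjes measure is built from such intervals and gives this one mass
   [y t - y s]. *)
pose D : set R := `]s, t]%classic.
have mD : measurable D by exact: measurable_itv.
have mf (A : set R) : measurable_fun A f.
  by apply: measurable_funTS; exact: continuous_measurable_fun.
have D0 u : D u -> 0 <= u.
  by rewrite /D/= in_itv/= => /andP[su _]; rewrite (le_trans s0)// ltW.
have : ((f r)%:E * lebesgue_stieltjes_measure y D <= 0)%E.
  rewrite -integral_cst// -int0.
  apply: (@le_trans _ _ (\int[lebesgue_stieltjes_measure y]_(u in D) (f u)%:E)%E).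
    apply: ge0_le_integral => //.
    - by move=> u _; rewrite lee_fin ltW.
    - by apply/measurable_EFinP; exact: mf.
    - move=> u; rewrite /D/= in_itv/= => /andP[su ut].
      by rewrite lee_fin fr// in_itv/= (ltW su).
  apply: ge0_subset_integral => //.
  - by apply/measurable_EFinP; exact: mf.
  - by move=> u /=; rewrite in_itv/= andbT lee_fin => /f0.
  - by move=> u /D0 u0 /=; rewrite in_itv/= andbT.
rewrite /lebesgue_stieltjes_measure/= /measure_extension measurable_mu_extE/=;
  last exact: is_ocitv.
rewrite wlength_itv_bnd// -EFinM lee_fin pmulr_rle0// subr_le0 => yts.
by apply/le_anti; rewrite yts andbT; exact: cumulative_is_nondecreasing.
Qed.

Lemma continuous_integrable_itv (R : realType) (g : R -> R) (s t : R) :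
  continuous g -> (@lebesgue_measure R).-integrable `[s, t] (EFin \o g).
Proof.
move=> cg; apply: continuous_compact_integrable; first exact: segment_compact.
exact: continuous_subspaceT.
Qed.

Lemma Rintegral_itv_chasles (R : realType) (g : R -> R) (a s t : R) :
  continuous g -> a <= s -> s <= t ->
  \int[lebesgue_measure]_(u in `[a, t]) g u =
  \int[lebesgue_measure]_(u in `[a, s]) g u +
  \int[lebesgue_measure]_(u in `[s, t]) g u.
Proof.
move=> cg as_ st; apply/eqP; rewrite addrC -subr_eq; apply/eqP.
rewrite (Rintegral_itvB (continuous_integrable_itv a t cg)) ?bnd_simp//.
apply: Rintegral_itv_obnd_cbnd.
apply: integrableS (continuous_integrable_itv s t cg) => //.
exact: subset_itv_oc_cc.
Qed.

Lemma Rintegral_itv_bounds (R : realType) (g : R -> R) (s t m M : R) :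
  continuous g -> s <= t ->
  (forall u, s <= u -> u <= t -> m <= g u <= M) ->
  m * (t - s) <= \int[lebesgue_measure]_(u in `[s, t]) g u <= M * (t - s).
Proof.
move=> cg st gb.
have ic (k : R) : \int[lebesgue_measure]_(u in `[s, t]) k = k * (t - s).
  rewrite Rintegral_cst//; congr (_ * _).
  transitivity (fine (lebesgue_measure (`[s, t]%classic : set R))) => //.
  rewrite lebesgue_measure_itv/= lte_fin; case: ltP => //= ts; apply/esym/eqP.
  by rewrite subr_eq0 eq_le ts st.
rewrite -!ic; apply/andP; split; apply: le_Rintegral => //;
  try exact: continuous_integrable_itv;
  try (by apply: continuous_integrable_itv => u; exact: cvg_cst);
  by move=> u /=; rewrite in_itv/= => /andP[su ut]; have /andP[] := gb u su ut.
Qed.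

(** * A single reflected coordinate *)

Section reflected_coordinate.
Context (R : realType) (f g : R -> R) (y : cumulative R R) (C : R).
Hypotheses (cf : continuous f) (cg : continuous g) (cy : continuous y).
Hypothesis f_ge0 : forall u, 0 <= u -> 0 <= f u.
Hypothesis g_le : forall u, `|g u| <= C.
Hypothesis fE : forall t, 0 <= t ->
  f t = f 0 + \int[lebesgue_measure]_(u in `[0, t]) g u + y t.
Hypothesis comp :
  (\int[lebesgue_stieltjes_measure y]_(u in `[0%R, +oo[) (f u)%:E = 0)%E.

Let I s t := \int[lebesgue_measure]_(u in `[s, t]) g u.

Lemma reflected_increment s t : 0 <= s -> s <= t ->
  f t - f s = I s t + (y t - y s).
Proof.
move=> s0 st; rewrite (fE s0) (fE (le_trans s0 st)).
by rewrite (Rintegral_itv_chasles cg s0 st) /I; ring.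
Qed.

Lemma reflected_integral_bounds s t : s <= t ->
  - (C * (t - s)) <= I s t <= C * (t - s).
Proof.
move=> st; rewrite -mulNr; apply: Rintegral_itv_bounds => // u _ _.
by rewrite -ler_norml.
Qed.

(** The regulator only pushes upwards, so any decrease is due to the drift. *)
Lemma reflected_lower s t : 0 <= s -> s <= t -> - (C * (t - s)) <= f t - f s.
Proof.
move=> s0 st; rewrite reflected_increment//.
have /andP[Il _] := reflected_integral_bounds st.
have : y s <= y t by exact: cumulative_is_nondecreasing.
lra.
Qed.

(* Going back to the last zero of [f] before [t], the regulator is frozen
   afterwards. *)
Lemma reflected_upper s t : 0 <= s -> s <= t -> f t - f s <= C * (t - s).
Proof.
move=> s0 st.
have C0 : 0 <= C by rewrite (le_trans _ (g_le 0)).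
have [pos|/existsNP[z0 /not_implyP[sz0 /not_implyP[z0t /negP]]]] :=
  pselect (forall u, s <= u -> u <= t -> 0 < f u).
  rewrite reflected_increment// -(stieltjes_constant cf f_ge0 comp s0 st pos).
  by rewrite subrr addr0; have /andP[] := reflected_integral_bounds st.
rewrite -leNgt => fz0.
pose Z : set R := `[s, t]%classic `&` [set u | f u <= 0].
have Z0 : Z !=set0 by exists z0; split; rewrite //= in_itv/= sz0.
have cZ : compact Z.
  apply: compact_closedI; first exact: segment_compact.
  apply: (@preimage_closed _ _ f [set v | v <= 0]); last exact: closed_le.
  by move=> u _; exact: cf.
have [r] := compact_EVT_max Z0 cZ (continuous_subspaceT (fun u : R => @cvg_id _ (nbhs u))).
rewrite inE => -[]; rewrite /= in_itv/= => /andP[sr rt] fr rmax.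
have r0 := le_trans s0 sr.
have pos u : r < u -> u <= t -> 0 < f u.
  move=> ru ut; rewrite ltNge; apply/negP => fu.
  have : u \in Z by rewrite inE; split; rewrite //= in_itv/= ut andbT (le_trans sr)// ltW.
  by move/rmax => /=; rewrite leNgt ru.
(* Positivity may fail at [r] itself, so the regulator is compared on [[u, t]] with [u > r], and [u]
   then tends to [r] by continuity of [y]. *)
have yrt : y t <= y r.
  have [->//|rt'] := eqVneq t r.
  have {}rt' : r < t by rewrite lt_neqAle eq_sym rt'.
  have ycvg : y u @[u --> at_right r] --> y r.
    by apply: cvg_at_right_filter; exact: cy.
  apply: (@cvgr_to_ge R (at_right r) _ R y (y r) (y t) ycvg).
  near=> u; have ru : r < u by near: u; exact: nbhs_right_gt.
  rewrite -(@stieltjes_constant _ y f u t)//.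
  - by rewrite (le_trans r0)// ltW.
  - by near: u; exact: nbhs_right_le.
  - by move=> v uv vt; apply: pos => //; rewrite (lt_le_trans _ uv).
have : f t - f r <= C * (t - r).
  rewrite reflected_increment//.
  by have /andP[_] := reflected_integral_bounds rt; lra.
have : C * (t - r) <= C * (t - s) by rewrite ler_wpM2l// lerB.
have := f_ge0 s0; lra.
Unshelve. all: by end_near. Qed.

Lemma reflected_lipschitz s t : 0 <= s -> s <= t -> `|f t - f s| <= C * (t - s).
Proof. by move=> s0 st; rewrite ler_norml reflected_lower ?reflected_upper. Qed.

(* The regulator only acts when [f s] is of order [t - s], where the term
   [f s * (y t - y s)] is quadratic in the step; the other term
   [- a * (y t - y s)] has a favourable sign. *)
Lemma reflected_square_step a s t : 0 <= a -> 0 <= s -> s <= t ->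
  (f t - a) ^+ 2 - (f s - a) ^+ 2 <=
  2 * (f s - a) * I s t + 5 * C ^+ 2 * (t - s) ^+ 2.
Proof.
move=> a0 s0 st; set d := t - s.
have C0 : 0 <= C by rewrite (le_trans _ (g_le 0)).
have d0 : 0 <= d by rewrite subr_ge0.
have Cd0 : 0 <= C * d by rewrite mulr_ge0.
have lo := reflected_lower s0 st; have up := reflected_upper s0 st.
have /andP[Il Iu] := reflected_integral_bounds st.
have inc := reflected_increment s0 st.
rewrite -/d in lo up Il Iu.
have dy0 : 0 <= y t - y s by rewrite subr_ge0; exact: cumulative_is_nondecreasing.
have fs0 := f_ge0 s0.
(* If [f s <= C * d], the bounds on [f] and on the integral give [y t - y s <= 2 * (C * d)].
   Otherwise [f] cannot reach 0 within the step and the regulator does not move. *)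
have fdy : f s * (y t - y s) <= 2 * (C * d) ^+ 2.
  have [fs|fs] := leP (f s) (C * d).
    have -> : 2 * (C * d) ^+ 2 = (C * d) * (2 * (C * d)) by ring.
    by apply: ler_pM => //; lra.
  rewrite (@stieltjes_constant _ y f s t)// ?subrr ?mulr0 ?mulr_ge0 ?sqr_ge0//.
  move=> u su ut; have := reflected_lower s0 su.
  have : C * (u - s) <= C * d by rewrite ler_wpM2l// lerB.
  lra.
have ady : 0 <= a * (y t - y s) by rewrite mulr_ge0.
have df2 : (f t - f s) ^+ 2 <= (C * d) ^+ 2.
  by rewrite -ler_sqrt ?sqr_ge0// !sqrtr_sqr (ger0_norm Cd0) ler_norml lo up.
(* The constant 5 is twice the 2 of [fdy] plus the 1 of [df2]. *)
have -> : (f t - a) ^+ 2 - (f s - a) ^+ 2 =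
    2 * (f s - a) * I s t + 2 * (f s * (y t - y s)) - 2 * (a * (y t - y s)) +
    (f t - f s) ^+ 2.
  have -> : f t = f s + (I s t + (y t - y s)) by rewrite -inc subrKC.
  by ring.
have -> : 5 * C ^+ 2 * d ^+ 2 = 5 * (C * d) ^+ 2 by ring.
lra.
Qed.

End reflected_coordinate.

(** * Decay along a time grid *)

(** The bound [max (2 * rho) (E 0 - kappa * t)] propagates from one multiple of [d] to the next:
    from above [rho] there is linear decay, from below [rho] a step ends under [2 * rho]. It also
    keeps [E] below [E 0 + 2 * rho] on the grid, which the decay hypothesis requires. *)
Lemma grid_decay (R : realType) (E : R -> R) (rho kappa d : R) :
  0 <= E 0 -> 0 < rho -> 0 < kappa -> 0 < d ->
  (forall s u, 0 <= s -> 0 <= u <= d -> rho <= E s -> E s <= E 0 + 2 * rho ->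
    E (s + u) <= E s - kappa * u) ->
  (forall s u, 0 <= s -> 0 <= u <= d -> E s <= rho -> E (s + u) <= 2 * rho) ->
  exists T, forall t, T <= t -> E t <= 2 * rho.
Proof.
move=> E0 rho0 k0 d0 Edec Esmall.
have nd0 n : 0 <= n%:R * d by rewrite mulr_ge0 ?(ltW d0).
have step n u : 0 <= u <= d ->
    E (n%:R * d) <= Num.max (2 * rho) (E 0 - kappa * d * n%:R) ->
    E (n%:R * d + u) <= Num.max (2 * rho) (E 0 - kappa * d * n%:R - kappa * u).
  move=> ud En; rewrite le_max.
  have [h|/ltW h] := leP (E (n%:R * d)) rho; first by rewrite Esmall.
  have kd0 : 0 <= kappa * d * n%:R by rewrite !mulr_ge0 ?(ltW k0) ?(ltW d0).
  have ku0 : 0 <= kappa * u by rewrite mulr_ge0 ?(ltW k0)//; case/andP: ud.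
  move: En; rewrite le_max => /orP[En|En].
  - have Es : E (n%:R * d) <= E 0 + 2 * rho by lra.
    by apply/orP; left; have := Edec _ _ (nd0 n) ud h Es; lra.
  - have Es : E (n%:R * d) <= E 0 + 2 * rho by lra.
    by apply/orP; right; have := Edec _ _ (nd0 n) ud h Es; lra.
have grid n : E (n%:R * d) <= Num.max (2 * rho) (E 0 - kappa * d * n%:R).
  elim: n => [|n IHn]; first by rewrite mul0r mulr0 subr0 le_max lexx orbT.
  have dd : 0 <= d <= d by rewrite lexx (ltW d0).
  have -> : n.+1%:R * d = n%:R * d + d by rewrite -natr1; ring.
  have -> : kappa * d * n.+1%:R = kappa * d * n%:R + kappa * d.
    by rewrite -natr1; ring.
  by rewrite opprD addrA; exact: step.
(* After [m] steps the linear branch is negative. *)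
pose m := Num.bound (E 0 / (kappa * d)).
exists (m%:R * d) => t mt.
have t0 : 0 <= t by rewrite (le_trans (nd0 m)).
have td0 : 0 <= t / d by rewrite divr_ge0 ?(ltW d0).
pose n := Num.truncn (t / d).
have /andP[nt tn] := truncn_itv td0.
have mn : (m <= n)%N by rewrite truncn_ge_nat// ler_pdivlMr.
have ud : 0 <= t - n%:R * d <= d.
  by move: nt tn; rewrite -/n ler_pdivlMr// ltr_pdivrMr// -natr1 mulrDl mul1r; lra.
have := step n _ ud (grid n); rewrite subrKC => /le_trans; apply.
rewrite ge_max lexx/=.
have ku0 : 0 <= kappa * (t - n%:R * d) by rewrite mulr_ge0 ?(ltW k0)//; case/andP: ud.
have : E 0 < kappa * d * m%:R.
  rewrite mulrC -ltr_pdivrMr ?mulr_gt0//.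
  by rewrite /m archi_boundP// divr_ge0// mulr_ge0 ?(ltW k0) ?(ltW d0).
have : kappa * d * m%:R <= kappa * d * n%:R
  by rewrite ler_wpM2l ?ler_nat ?mulr_ge0 ?(ltW k0) ?(ltW d0).
lra.
Qed.

(** * A sign inequality for exponentially tilted laws *)

Lemma mul_expRN_sub1_le0 (R : realType) (y : R) : y * (expR (- y) - 1) <= 0.
Proof.
have [y0|y0] := leP 0 y.
- by rewrite mulr_ge0_le0// subr_le0 expR_le1 oppr_le0.
- by rewrite mulr_le0_ge0 ?ltW// subr_gt0 expR_gt1 oppr_gt0.
Qed.

Lemma mul_expRN_sub1_eq0 (R : realType) (y : R) :
  y * (expR (- y) - 1) = 0 -> y = 0.
Proof.
move=> /eqP; rewrite mulf_eq0 => /orP[/eqP//|]; rewrite subr_eq0 => /eqP h.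
have [|y0|//] := ltgtP y 0.
- by rewrite -oppr_gt0 -expR_gt1 h ltxx.
- by move: y0; rewrite -oppr_lt0 -expR_lt1 h ltxx.
Qed.

(* Centring [x] at [z = - ln Z] turns the tilted law into
   [p i * expR (- (x i - z))], so that the sum splits into terms of constant
   sign; shifting [x] is free because both laws have mass 1. *)
Lemma tilted_dissipation (R : realType) (N : nat) (p mu x : 'I_N -> R)
    (lambda : R) :
  (forall i, 0 < p i) -> \sum_i p i = 1 -> 0 < lambda ->
  lambda < \sum_i mu i ->
  (forall i, x i * (lambda * p i - mu i) <= 0) ->
  let Z := \sum_j p j * expR (- x j) in
  let S := \sum_i x i * (lambda * (p i * expR (- x i) / Z) - mu i) in
  S <= 0 /\ (S = 0 -> forall i, x i = 0).
Proof.
move=> p0 p1 l0 lmu xle Z S.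
have N0 : (0 < N)%N.
  rewrite lt0n; apply/eqP => N0; have := oner_neq0 R; rewrite -p1 big1 ?eqxx//.
  by case=> i iN _; exfalso; move: iN; rewrite N0.
have Z0 : 0 < Z.
  rewrite /Z (bigD1 (Ordinal N0))//= ltr_pwDl ?mulr_gt0 ?expR_gt0//.
  by apply: sumr_ge0 => i _; rewrite mulr_ge0 ?expR_ge0 ?ltW.
pose z := - ln Z.
pose A i := p i * ((x i - z) * (expR (- (x i - z)) - 1)).
pose B i := x i * (lambda * p i - mu i).
have eZ i : expR (- (x i - z)) = expR (- x i) / Z.
  by rewrite opprB /z expRD expRN lnK// mulrC.
have p'1 : \sum_i p i * (expR (- x i) / Z) = 1.
  under eq_bigr do rewrite mulrA.
  by rewrite -mulr_suml divff// gt_eqF.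
(* Termwise the two sides differ by [lambda * z] times the difference of the tilted and original
   masses, and both laws have total mass 1. *)
have ES : S = lambda * \sum_i A i + \sum_i B i.
  have : S - lambda * \sum_i A i - \sum_i B i =
      lambda * z * (\sum_i p i * (expR (- x i) / Z) - \sum_i p i).
    rewrite /S mulr_sumr -!sumrB mulr_sumr; apply: eq_bigr => i _.
    by rewrite /A /B eZ; ring.
  by rewrite p'1 p1 subrr mulr0 => h; lra.
have A0 i : A i <= 0 by rewrite mulr_ge0_le0 ?(ltW (p0 _))// mul_expRN_sub1_le0.
have SA0 : \sum_i A i <= 0 by apply: sumr_le0 => i _.
have SB0 : \sum_i B i <= 0 by apply: sumr_le0 => i _; exact: xle.
have lA0 : lambda * \sum_i A i <= 0 by rewrite mulr_ge0_le0 ?(ltW l0).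
split=> [|S0]; first by rewrite ES; lra.
have /eqP : lambda * \sum_i A i = 0 by lra.
rewrite mulf_eq0 gt_eqF//= => /eqP SA.
(* When [S] vanishes, so does every [A i], which makes [x] constant; then the [B i] sum to
   [z * (lambda - \sum_i mu i)], and strict stability forces [z = 0]. *)
have xz i : x i = z.
  apply/eqP; rewrite -subr_eq0; apply/eqP/mul_expRN_sub1_eq0.
  have : - A i = 0.
    have : \sum_i - A i = 0 by rewrite sumrN SA oppr0.
    by move/eqP; rewrite psumr_eq0 => [/allP/(_ i)|j _];
      [rewrite mem_index_enum => /(_ isT)/eqP|rewrite oppr_ge0].
  by move=> /eqP; rewrite oppr_eq0 mulf_eq0 gt_eqF//= => /eqP.
have SB : z * (lambda - \sum_i mu i) = 0.
  have -> : z * (lambda - \sum_i mu i) = \sum_i B i.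
    rewrite -[lambda]mulr1 -p1 mulr_sumr -sumrB mulr_sumr.
    by apply: eq_bigr => i _; rewrite /B xz.
  by lra.
move=> i; rewrite xz; move/eqP: SB; rewrite mulf_eq0 => /orP[/eqP//|].
by rewrite subr_eq0 lt_eqF.
Qed.

(** * Routing weights and the effect of moving the state *)

Section uas.
Context (R : realType) (N : nat) (alpha beta gamma c : R) (mu : 'I_N -> R)
  (lambda : R).
Hypotheses (hN : (1 <= N)%N) (halpha : 0 < alpha) (hmu : forall i, 0 < mu i).
Hypotheses (hlambda : 0 < lambda) (hstable : lambda < \sum_i mu i).

Let rate i := alpha / mu i `^ beta.
Let w := weight alpha beta gamma c mu.
Let p := routing alpha beta gamma c mu.
Let F := drift alpha beta gamma c mu lambda.
Let th := theta alpha beta gamma c mu.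

Let rate_gt0 i : 0 < rate i.
Proof. by rewrite divr_gt0// powR_gt0. Qed.

Lemma theta_gt0 i : 0 < th i.
Proof. by rewrite /th /theta mulr_gt0 ?powR_gt0 ?expR_gt0. Qed.

Lemma weight_gt0 q i : 0 < w q i.
Proof. by rewrite mulr_gt0 ?powR_gt0 ?expR_gt0. Qed.

(** The factor [mu i * th i] is the weight of an empty queue. *)
Lemma weightE q i : w q i = mu i * th i * expR (- (rate i * q 0 i)).
Proof.
have m0 : mu i != 0 by rewrite gt_eqF.
have mg : mu i * mu i `^ (gamma - 1) = mu i `^ gamma.
  by rewrite -[X in X * _]powRr1 ?ltW// -powRD ?m0 ?implybT// addrC subrK.
rewrite /w /weight /th /theta mulrA mg -[RHS]mulrA -expRD; congr (_ * expR _).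
by rewrite /rate; ring.
Qed.

Lemma weight_shift q q' i :
  w q' i = w q i * expR (- (rate i * (q' 0 i - q 0 i))).
Proof.
by rewrite !weightE -[RHS]mulrA -expRD -opprD -mulrDr subrKC.
Qed.

Lemma sum_weight_gt0 q : 0 < \sum_j w q j.
Proof.
rewrite (bigD1 (Ordinal hN))//= ltr_pwDl ?weight_gt0// sumr_ge0// => i _.
exact/ltW/weight_gt0.
Qed.

Lemma routing_gt0 q i : 0 < p q i.
Proof. by rewrite divr_gt0 ?weight_gt0 ?sum_weight_gt0. Qed.

Lemma sum_routing q : \sum_i p q i = 1.
Proof. by rewrite -mulr_suml divff// gt_eqF// sum_weight_gt0. Qed.

Lemma routing_le1 q i : p q i <= 1.
Proof.
rewrite -(sum_routing q) (bigD1 i)//= lerDl sumr_ge0// => j _.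
exact/ltW/routing_gt0.
Qed.

(** Moving the state tilts the routing law exponentially, which is the form [tilted_dissipation]
    expects. *)
Lemma routing_shift q q' i :
  p q' i = p q i * expR (- (rate i * (q' 0 i - q 0 i))) /
    \sum_j p q j * expR (- (rate j * (q' 0 j - q 0 j))).
Proof.
have -> : \sum_j p q j * expR (- (rate j * (q' 0 j - q 0 j))) =
    (\sum_j w q' j) / \sum_j w q j.
  rewrite mulr_suml; apply: eq_bigr => j _.
  by rewrite (weight_shift q q') /p /routing mulrAC.
rewrite /p /routing -/w (weight_shift q q').
have := sum_weight_gt0 q; have := sum_weight_gt0 q'.
set a := \sum_j _; set b := \sum_j _ => a0 b0.
by field; rewrite !gt_eqF.
Qed.

(** * Dissipation and uniqueness of the equilibrium *)

Lemma equilibriumP q :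
  equilibrium alpha beta gamma c mu lambda q <->
  forall i, [/\ 0 <= q 0 i, F q i <= 0 & q 0 i * F q i = 0].
Proof.
split=> [[q0 h] i|h].
- have := h i; rewrite /reflected_drift -/F; have [qi h0|qi h0] := ltP.
  + by rewrite h0 mulr0; split => //; exact: q0.
  + have -> : q 0 i = 0 by apply/eqP; rewrite eq_le qi q0.
    by split=> //; [rewrite -h0 le_max lexx|rewrite mul0r].
- split=> [i|i]; first by have [] := h i.
  have [q0 F0 qF] := h i; rewrite /reflected_drift -/F; case: ltP => [qi|_].
  + by move/eqP: qF; rewrite mulf_eq0 gt_eqF//= => /eqP.
  + exact: max_r.
Qed.

(** Half the derivative of [lyapunov qs] along the unconstrained drift. *)
Definition dissipation (qs q : 'rV[R]_N) :=
  \sum_i (rate i * (q 0 i - qs 0 i)) * F q i.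

(** Take the law at [qs] as base law and tilt it to [q]. Complementarity at [qs] reduces
    [(q_i - qs_i) * F_i(qs)] to [q_i * F_i(qs) <= 0], the sign condition needed. *)
Lemma dissipation_le0 qs q :
  equilibrium alpha beta gamma c mu lambda qs -> orthant q ->
  dissipation qs q <= 0 /\ (dissipation qs q = 0 -> q = qs).
Proof.
move=> /equilibriumP hqs q0.
have := @tilted_dissipation R N (p qs) mu
  (fun i => rate i * (q 0 i - qs 0 i)) lambda.
move=> /(_ (routing_gt0 qs) (sum_routing qs) hlambda hstable).
have H i : rate i * (q 0 i - qs 0 i) * (lambda * p qs i - mu i) <= 0.
  have [qs0 F0 qF] := hqs i; rewrite -mulrA mulr_ge0_le0 ?(ltW (rate_gt0 _))//.
  by rewrite mulrBl qF subr0 mulr_ge0_le0// q0.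
move=> /(_ H) /=.
have -> : \sum_i rate i * (q 0 i - qs 0 i) *
    (lambda * (p qs i * expR (- (rate i * (q 0 i - qs 0 i))) /
      (\sum_j p qs j * expR (- (rate j * (q 0 j - qs 0 j))))) - mu i) =
    dissipation qs q.
  by apply: eq_bigr => i _; rewrite -(routing_shift qs q).
move=> [D0 Deq]; split=> // /Deq qqs; apply/rowP => i.
move/eqP: (qqs i); rewrite mulf_eq0 (gt_eqF (rate_gt0 i))/= subr_eq0.
by move=> /eqP.
Qed.

(** Complementarity at [q] turns each [(q_i - qs_i) * F_i(q)] into [- qs_i * F_i(q) >= 0], so the
    dissipation, already nonpositive, is zero. *)
Lemma equilibrium_unique qs q :
  equilibrium alpha beta gamma c mu lambda qs ->
  equilibrium alpha beta gamma c mu lambda q -> qs = q.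
Proof.
move=> hqs hq; have [D0 Deq] := dissipation_le0 hqs hq.1.
apply/esym/Deq/le_anti/andP; split=> //; apply: sumr_ge0 => i _.
move/equilibriumP: hq => /(_ i)[q0 F0 qF].
move/equilibriumP: hqs => /(_ i)[qs0 _ _].
rewrite -mulrA mulr_ge0 ?(ltW (rate_gt0 _))//.
by rewrite mulrBl qF sub0r oppr_ge0 mulr_ge0_le0.
Qed.

(** * The explicit equilibrium and the balance equation *)

(** If [K <= th i], the queue grows until its weight drops to [mu i * K]; otherwise it is empty with
    weight [mu i * th i]. Under the balance equation these weights sum to [lambda * K], so the
    minimum is the arrival rate at server [i]. *)
Lemma weight_qstar K i : 0 < K ->
  w (qstar alpha beta gamma c mu K) i = Num.min (mu i) (mu i * th i / K) * K.
Proof.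
move=> K0; have t0 := theta_gt0 i; have m0 := hmu i.
have r0 := rate_gt0 i; have b0 := powR_gt0 beta m0.
have e : rate i * (mu i `^ beta / alpha * ln (th i / K)) = ln (th i / K).
  by rewrite /rate; field; rewrite !gt_eqF.
rewrite weightE mxE -/(th i); have [h|h] := leP K (th i).
- have tK : 1 <= th i / K by rewrite ler_pdivlMr ?mul1r.
  rewrite max_r; last by rewrite -(pmulr_rge0 _ r0) e ln_ge0.
  rewrite e expRN lnK ?posrE ?divr_gt0// min_l; last by rewrite -mulrA ler_peMr ?(ltW m0).
  by field; rewrite !gt_eqF.
- have tK : th i / K < 1 by rewrite ltr_pdivrMr ?mul1r.
  rewrite max_l; last by rewrite -(pmulr_rle0 _ r0) e -ln1 ler_ln ?posrE ?divr_gt0 ?ltW.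
  rewrite mulr0 oppr0 expR0 min_r; first by field; rewrite gt_eqF.
  by rewrite -mulrA ger_pMr ?(ltW tK).
Qed.

Lemma balance_sum_weight K : 0 < K ->
  balance alpha beta gamma c mu lambda K ->
  \sum_i w (qstar alpha beta gamma c mu K) i = lambda * K.
Proof.
move=> K0 ->; rewrite mulr_suml; apply: eq_bigr => i _.
by rewrite weight_qstar.
Qed.

Lemma balance_equilibrium K : 0 < K ->
  balance alpha beta gamma c mu lambda K ->
  equilibrium alpha beta gamma c mu lambda (qstar alpha beta gamma c mu K).
Proof.
move=> K0 bK; apply/equilibriumP => i.
have FE : F (qstar alpha beta gamma c mu K) i =
    Num.min (mu i) (mu i * th i / K) - mu i.
  rewrite /F /drift /routing -/w balance_sum_weight// weight_qstar//.
  by congr (_ - _); field; rewrite !gt_eqF.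
split; first by rewrite mxE le_max lexx.
  by rewrite FE subr_le0 ge_min lexx.
rewrite FE mxE -/(th i); have [h|h] := leP K (th i).
  rewrite min_l ?subrr ?mulr0// -mulrA ler_peMr ?(ltW (hmu _))//.
  by rewrite ler_pdivlMr ?mul1r.
rewrite max_l ?mul0r// mulr_ge0_le0 ?divr_ge0 ?powR_ge0 ?(ltW halpha)//.
by rewrite -ln1 ler_ln ?posrE ?divr_gt0 ?theta_gt0// ler_pdivrMr ?mul1r ?(ltW h).
Qed.

(** Both constants yield the same equilibrium, hence the same total weight, which is [lambda] times
    the constant. *)
Lemma balance_unique K K' : 0 < K -> 0 < K' ->
  balance alpha beta gamma c mu lambda K ->
  balance alpha beta gamma c mu lambda K' -> K = K'.
Proof.
move=> K0 K'0 bK bK'; apply: (mulfI (lt0r_neq0 hlambda)).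
rewrite -!balance_sum_weight//; apply: eq_bigr => i _; congr (w _ _).
by apply: equilibrium_unique; exact: balance_equilibrium.
Qed.

Lemma balance_exists : exists2 K, 0 < K & balance alpha beta gamma c mu lambda K.
Proof.
(* The variable of [g] stands for the inverse of the constant sought, so the intermediate value
   theorem applies on a segment starting at 0. *)
pose g K := \sum_i Num.min (mu i) (mu i * th i * K).
have cg : continuous g.
  move=> K; apply: cvg_big => [|i _]; first exact: add_continuous.
  by apply: continuous_min; [exact: cvg_cst|apply: cvgM; [exact: cvg_cst|exact: cvg_id]].
have g0 : g 0 = 0.
  by rewrite /g big1// => i _; rewrite mulr0 min_r// ltW.
(* This dominates every [(th i)^-1], so all minima are saturated at [b]. *)
pose b := \sum_i (th i)^-1.
have gb : g b = \sum_i mu i.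
  apply: eq_bigr => i _; rewrite min_l// -mulrA ler_peMr ?(ltW (hmu i))//.
  rewrite -ler_pdivrMl ?theta_gt0// mulr1 /b (bigD1 i)//= lerDl sumr_ge0// => j _.
  by rewrite invr_ge0 ltW ?theta_gt0.
have b0 : 0 <= b by apply: sumr_ge0 => j _; rewrite invr_ge0 ltW ?theta_gt0.
have [|x] := @IVT R g 0 b lambda b0 (continuous_subspaceT cg).
  by rewrite g0 gb ge_min le_max (ltW hlambda) (ltW hstable) orbT.
rewrite in_itv/= => /andP[x0 xb] gx.
have {}x0 : 0 < x.
  rewrite lt_neqAle x0 andbT; apply/eqP => x0'; move: gx hlambda.
  by rewrite -x0' g0 => <-; rewrite ltxx.
exists x^-1; first by rewrite invr_gt0.
by rewrite /balance -gx invrK.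
Qed.

(** * Continuity, the Lyapunov function and compactness *)

(** An arbitrary source space lets these continuity results serve both on the state space and along
    a trajectory. *)
Lemma continuous_weight (T : topologicalType) (q : T -> 'rV[R]_N) i :
  (forall j, continuous (fun x => q x 0 j)) -> continuous (fun x => w (q x) i).
Proof.
move=> cq.
suff : continuous (fun x =>
    mu i `^ gamma * expR (- (alpha * (q x 0 i + c) / mu i `^ beta))) by [].
move=> x; apply: cvgM; first exact: cvg_cst.
apply: (@continuous_comp _ _ _
  (fun x => - (alpha * (q x 0 i + c) / mu i `^ beta)) (@expR R));
  last exact: continuous_expR.
apply: cvgN; apply: cvgM; last exact: cvg_cst.
apply: cvgM; first exact: cvg_cst.
by apply: cvgD; [exact: cq|exact: cvg_cst].
Qed.

Lemma continuous_drift (T : topologicalType) (q : T -> 'rV[R]_N) i :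
  (forall j, continuous (fun x => q x 0 j)) -> continuous (fun x => F (q x) i).
Proof.
move=> cq; suff : continuous (fun x =>
    lambda * (w (q x) i / \sum_j w (q x) j) - mu i) by [].
move=> x; apply: cvgB; last exact: cvg_cst.
apply: cvgM; first exact: cvg_cst.
apply: cvgM; first exact: continuous_weight.
apply: cvgV; first by rewrite gt_eqF ?sum_weight_gt0.
apply: cvg_big => [|j _]; first exact: add_continuous.
exact: continuous_weight.
Qed.

Definition lyapunov (qs q : 'rV[R]_N) := \sum_i rate i * (q 0 i - qs 0 i) ^+ 2.

Lemma lyapunov_ge0 qs q : 0 <= lyapunov qs q.
Proof.
by apply: sumr_ge0 => i _; rewrite mulr_ge0 ?sqr_ge0 ?(ltW (rate_gt0 i)).
Qed.

Lemma le_lyapunov (qs q : 'rV[R]_N) i : rate i * (q 0 i - qs 0 i) ^+ 2 <= lyapunov qs q.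
Proof.
rewrite /lyapunov (bigD1 i)//= lerDl sumr_ge0// => j _.
by rewrite mulr_ge0 ?sqr_ge0 ?(ltW (rate_gt0 j)).
Qed.

Lemma continuous_lyapunov (T : topologicalType) (q : T -> 'rV[R]_N) qs :
  (forall j, continuous (fun x => q x 0 j)) ->
  continuous (fun x => lyapunov qs (q x)).
Proof.
move=> cq x; apply: cvg_big => [|i _]; first exact: add_continuous.
apply: cvgM; first exact: cvg_cst.
by apply: cvgM; apply: cvgB; [exact: cq|exact: cvg_cst|exact: cq|exact: cvg_cst].
Qed.

Lemma continuous_dissipation (T : topologicalType) (q : T -> 'rV[R]_N) qs :
  (forall j, continuous (fun x => q x 0 j)) ->
  continuous (fun x => dissipation qs (q x)).
Proof.
move=> cq x; apply: cvg_big => [|i _]; first exact: add_continuous.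
apply: cvgM; last exact: continuous_drift.
apply: cvgM; first exact: cvg_cst.
by apply: cvgB; [exact: cq|exact: cvg_cst].
Qed.

(** The region is compact, so the dissipation attains its maximum there; this is negative because
    [lyapunov qs] vanishes at [qs], which is thereby excluded. *)
Lemma dissipation_uniform qs (rho M : R) :
  equilibrium alpha beta gamma c mu lambda qs -> 0 < rho ->
  exists2 kappa, 0 < kappa & forall q, orthant q ->
    rho <= lyapunov qs q -> lyapunov qs q <= M -> dissipation qs q <= - kappa.
Proof.
move=> hqs rho0.
have cq j : continuous (fun q : 'rV[R]_N => q 0 j) by exact: coord_continuous.
have cL : continuous (lyapunov qs) := continuous_lyapunov cq.
(* A radius without square roots: [|x| <= 1 + x ^+ 2]. *)
pose r i := 1 + M / rate i.
pose A : set 'rV[R]_N :=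
  [set q : 'rV[R]_N | forall i, `[qs 0 i - r i, qs 0 i + r i]%classic (q ord0 i)] `&`
  ([set q : 'rV[R]_N | forall i, 0 <= q 0 i] `&`
  (lyapunov qs @^-1` [set v | rho <= v] `&` lyapunov qs @^-1` [set v | v <= M])).
have cA : compact A.
  apply: compact_closedI.
    exact: (@rV_compact R N (fun i => `[qs 0 i - r i, qs 0 i + r i]%classic)
      (fun i => @segment_compact _ _ _)).
  apply: closedI; last apply: closedI.
  - have -> : [set q : 'rV[R]_N | forall i, 0 <= q 0 i] =
        \bigcap_(i in [set: 'I_N]) ((fun q : 'rV[R]_N => q 0 i) @^-1` [set v | 0 <= v]).
      by apply/seteqP; split=> [q h i _|q h i]; [exact: h|exact: (h i)].
    apply: closed_bigI => i _; apply: preimage_closed; last exact: closed_ge.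
    by move=> q _; exact: coord_continuous.
  - apply: preimage_closed; last exact: closed_ge.
    by move=> q _; exact: cL.
  - apply: preimage_closed; last exact: closed_le.
    by move=> q _; exact: cL.
have AP q : orthant q -> rho <= lyapunov qs q -> lyapunov qs q <= M -> A q.
  move=> q0 h1 h2; split=> // i; rewrite /= in_itv/= -ler_distl.
  set x := q 0 i - qs 0 i.
  have : x ^+ 2 <= M / rate i.
    by rewrite ler_pdivlMr// mulrC (le_trans (le_lyapunov qs q i)).
  rewrite /r ler_norml; move: (M / rate i) => m xm.
  have := sqr_ge0 (x - 1); have := sqr_ge0 (x + 1).
  by rewrite !expr2 in xm *; move=> *; apply/andP; split; lra.
(* If the region is empty, any positive constant will do. *)
have [A0|/set0P/negP/negPn/eqP A0] := pselect (A !=set0); last first.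
  by exists 1 => // q q0 h1 h2; have := AP q q0 h1 h2; rewrite A0.
have [q] := EVT_max_rV A0 cA (continuous_subspaceT (@continuous_dissipation _ id qs cq)).
rewrite inE => -[_ [q0 [/= rq qM]]] qmax.
have [D0 Deq] := dissipation_le0 hqs q0.
exists (- dissipation qs q).
  rewrite oppr_gt0 lt_neqAle D0 andbT; apply/eqP => /Deq qqs.
  move: rq; rewrite qqs /lyapunov big1 ?leNgt ?rho0// => i _.
  by rewrite subrr expr0n mulr0.
move=> q' q'0 h1 h2; rewrite opprK; apply: qmax.
by rewrite inE; exact: AP.
Qed.

(** * One-step estimate and convergence of trajectories *)

(** Each weight, and so their sum, changes by a factor at most [expR eta]; the quotient changes by
    at most [expR (2 * eta)], and probabilities are at most 1. *)
Lemma drift_modulus (q q' : 'rV[R]_N) (eta : R) i :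
  (forall j, rate j * `|q' 0 j - q 0 j| <= eta) ->
  `|F q' i - F q i| <= lambda * (expR (2 * eta) - 1).
Proof.
move=> hq.
have step (q1 q2 : 'rV[R]_N) : (forall j, rate j * `|q2 0 j - q1 0 j| <= eta) ->
    p q2 i - p q1 i <= expR (2 * eta) - 1.
  move=> h12.
  have wle (q3 q4 : 'rV[R]_N) j : (forall j, rate j * `|q4 0 j - q3 0 j| <= eta) ->
      w q4 j <= w q3 j * expR eta.
    move=> h34; rewrite (weight_shift q3) ler_wpM2l ?(ltW (weight_gt0 _ _))//.
    rewrite ler_expR (le_trans _ (h34 j))// -mulrN ler_wpM2l ?(ltW (rate_gt0 _))//.
    by rewrite (le_trans (ler_norm _))// normrN.
  have Wle : \sum_j w q1 j <= (\sum_j w q2 j) * expR eta.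
    rewrite mulr_suml ler_sum// => j _; apply: wle => k.
    by rewrite distrC.
  have e1 : 1 <= expR (2 * eta).
    rewrite -expR0 ler_expR mulr_ge0// (le_trans _ (hq i))//.
    by rewrite mulr_ge0// ltW.
  have W1 := sum_weight_gt0 q1; have W2 := sum_weight_gt0 q2.
  have : p q2 i <= p q1 i * expR (2 * eta).
    have -> : 2 * eta = eta + eta by ring.
    rewrite ler_pdivrMr// expRD.
    have -> : p q1 i * (expR eta * expR eta) * \sum_j w q2 j =
        (w q1 i * expR eta) * ((\sum_j w q2 j) * expR eta) / \sum_j w q1 j.
      by rewrite /p /routing -/w; field; rewrite gt_eqF.
    by rewrite ler_pdivlMr// ler_pM// ?wle// ltW// weight_gt0.
  have := routing_le1 q1 i; have := routing_gt0 q1 i => p0 p1 h.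
  rewrite (@le_trans _ _ (p q1 i * (expR (2 * eta) - 1)))//; first lra.
  by rewrite -[leRHS]mul1r ler_wpM2r// subr_ge0.
have -> : F q' i - F q i = lambda * (p q' i - p q i).
  by rewrite /F /drift -/(p q i) -/(p q' i); ring.
rewrite normrM (gtr0_norm hlambda) ler_wpM2l ?(ltW hlambda)// ler_norml.
rewrite step// andbT lerNl opprB step// => j.
by rewrite distrC.
Qed.

Lemma drift_bound q i : `|F q i| <= lambda + \sum_j mu j.
Proof.
have mui : mu i <= \sum_j mu j.
  by rewrite (bigD1 i)//= lerDl sumr_ge0// => j _; exact/ltW.
have m0 := hmu i.
have : 0 <= lambda * p q i by rewrite mulr_ge0 ?ltW// routing_gt0.
have : lambda * p q i <= lambda by rewrite ger_pMr// routing_le1.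
rewrite ler_norml /F /drift -/(p q i) => *; apply/andP; split; lra.
Qed.

(** The square estimates of the coordinates are summed with weights [rate i]. The exponential error
    comes from freezing the drift at time [s], the one with factor 5 from the quadratic terms of
    these estimates. *)
Lemma lyapunov_step (q : R -> 'rV[R]_N) qs (s u : R) :
  reflected_trajectory alpha beta gamma c mu lambda q ->
  equilibrium alpha beta gamma c mu lambda qs -> 0 <= s -> 0 <= u ->
  lyapunov qs (q (s + u)) <= lyapunov qs (q s) +
    u * (2 * dissipation qs (q s) + ((\sum_i rate i + lyapunov qs (q s)) *
      (lambda * (expR (2 * ((\sum_i rate i) * ((lambda + \sum_i mu i) * u))) - 1)) +
      5 * (\sum_i rate i) * (lambda + \sum_i mu i) ^+ 2 * u)).
Proof.
move=> [qc q_ge0 [y hy]] hqs s0 u0.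
set A := \sum_i rate i; set C := lambda + \sum_i mu i.
have C0 : 0 <= C by rewrite addr_ge0 ?sumr_ge0 ?ltW// => i _; exact: ltW.
(* Extending [q] by its initial value to negative times gives the continuity on the whole line that
   the one-coordinate lemmas ask for. *)
pose Q t := q (Num.max 0 t).
have QE t : 0 <= t -> Q t = q t by move=> t0; rewrite /Q max_r.
have cQ i : continuous (fun t => Q t 0 i).
  move=> t; apply: (@continuous_comp _ _ _ Q (fun q : 'rV[R]_N => q 0 i));
    last exact: coord_continuous.
  apply: (@cvg_comp _ _ _ (fun v : R => Num.max 0 v) q _
      (within `[0, +oo[%classic (nbhs (Num.max 0 t)))); last first.
    apply: ((subspace_continuousP _ _).1 qc).
    by rewrite /= in_itv/= andbT le_max lexx.
  move=> P; rewrite /within/= => nP.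
  have cm : {for t, continuous (fun v : R => Num.max 0 v)}.
    by apply: continuous_max; [exact: cvg_cst|exact: cvg_id].
  have := cm _ nP; apply: (@filterS _ (nbhs t)) => v; apply.
  by rewrite /= in_itv/= andbT le_max lexx.
have Q_ge0 i t : 0 <= t -> 0 <= Q t 0 i by move=> t0; rewrite QE//; exact: q_ge0.
have cF i : continuous (fun t => F (Q t) i) by apply: continuous_drift.
have FC i t : `|F (Q t) i| <= C by apply: drift_bound.
have QI i t : 0 <= t -> Q t 0 i = Q 0 0 i +
    \int[lebesgue_measure]_(v in `[0, t]) F (Q v) i + y i t.
  move=> t0; have [_ _ /(_ t t0) qt _] := hy i.
  rewrite (QE t t0) qt (QE 0 (lexx 0)).
  have -> // : \int[lebesgue_measure]_(v in `[0, t]) F (Q v) i =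
      \int[lebesgue_measure]_(v in `[0, t]) drift alpha beta gamma c mu lambda (q v) i.
  apply: eq_Rintegral => v.
  by rewrite inE/= in_itv/= => /andP[v0 _]; rewrite (QE v v0).
have Qcomp i : (\int[lebesgue_stieltjes_measure (y i)]_(v in `[0%R, +oo[)
    (Q v 0%R i)%:E = 0)%E.
  have [_ _ _ <-] := hy i; apply: eq_integral => v.
  by rewrite inE/= in_itv/= andbT => v0; rewrite (QE v v0).
have cy i : continuous (y i) by have [] := hy i.
have su : s <= s + u by rewrite lerDl.
rewrite -(QE s s0) -(QE (s + u) (addr_ge0 s0 u0)).
have lip i v : s <= v -> v <= s + u -> `|Q v 0 i - Q s 0 i| <= C * u.
  move=> sv vu; rewrite (le_trans (reflected_lipschitz (cQ i) (cF i) (cy i)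
    (Q_ge0 i) (FC i) (QI i) (Qcomp i) s0 sv))// ler_wpM2l//; lra.
pose om := lambda * (expR (2 * (A * (C * u))) - 1).
have dF i v : s <= v -> v <= s + u -> `|F (Q v) i - F (Q s) i| <= om.
  move=> sv vu; apply: drift_modulus => j.
  apply: ler_pM; rewrite ?(ltW (rate_gt0 _))//; last exact: lip.
  by rewrite /A (bigD1 j)//= lerDl sumr_ge0// => k _; exact/ltW/rate_gt0.
pose I i := \int[lebesgue_measure]_(v in `[s, s + u]) F (Q v) i.
have Ib i : `|I i - F (Q s) i * u| <= om * u.
  have := @Rintegral_itv_bounds _ _ s (s + u) (F (Q s) i - om) (F (Q s) i + om)
    (cF i) su.
  have -> : s + u - s = u by ring.
  move=> /(_ _)/wrap[v sv vu|].
    by have := dF i v sv vu; rewrite ler_distl.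
  rewrite -/(I i); move: (F (Q s) i) (I i) => a b; rewrite mulrBl mulrDl.
  by move=> /andP[lo hi]; rewrite ler_norml; apply/andP; split; lra.
have coord i : rate i * (Q (s + u) 0 i - qs 0 i) ^+ 2 <=
    rate i * (Q s 0 i - qs 0 i) ^+ 2 +
    u * (2 * (rate i * (Q s 0 i - qs 0 i) * F (Q s) i) +
      ((rate i + rate i * (Q s 0 i - qs 0 i) ^+ 2) * om + 5 * rate i * C ^+ 2 * u)).
  have := reflected_square_step (cQ i) (cF i) (cy i) (Q_ge0 i) (FC i) (QI i)
    (Qcomp i) (hqs.1 i) s0 su.
  have -> : s + u - s = u by ring.
  rewrite -/(I i); set x := Q s 0 i - qs 0 i; set z := Q (s + u) 0 i - qs 0 i.
  move=> hz.
  (* The inequality [2 * |x| <= 1 + x ^+ 2] lets the Lyapunov function absorb the factor [x]. *)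
  have hx : 2 * x * (I i - F (Q s) i * u) <= (1 + x ^+ 2) * (om * u).
    rewrite (le_trans (ler_norm _))// normrM ler_pM// normrM ger0_norm//.
    have := sqr_ge0 (`|x| - 1); rewrite -[x ^+ 2]real_normK ?num_real// !expr2.
    lra.
  have : z ^+ 2 <= x ^+ 2 + u * (2 * (x * F (Q s) i) +
      ((1 + x ^+ 2) * om + 5 * C ^+ 2 * u)) by lra.
  rewrite -(ler_pM2l (rate_gt0 i)) => /le_trans; apply.
  by rewrite le_eqVlt; apply/orP; left; apply/eqP; ring.
apply: (le_trans (ler_sum _ (fun i _ => coord i))).
have e1 : \sum_i (rate i + rate i * (Q s 0 i - qs 0 i) ^+ 2) * om =
    (A + lyapunov qs (Q s)) * om by rewrite -mulr_suml big_split.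
have e2 : \sum_i 5 * rate i * C ^+ 2 * u = 5 * A * C ^+ 2 * u.
  by rewrite -!mulr_suml -mulr_sumr.
by rewrite big_split/= -mulr_sumr big_split/= -mulr_sumr big_split/= e1 e2.
Qed.

(** For steps at most [d] the error [h] is below [kappa], while twice the dissipation is at most
    [- 2 * kappa] where the Lyapunov function lies between [rho] and [M]; a net decay rate [kappa]
    remains for [grid_decay]. *)
Lemma lyapunov_decay (q : R -> 'rV[R]_N) qs (rho : R) :
  reflected_trajectory alpha beta gamma c mu lambda q ->
  equilibrium alpha beta gamma c mu lambda qs -> 0 < rho ->
  exists T, forall t, T <= t -> lyapunov qs (q t) <= 2 * rho.
Proof.
move=> hq hqs rho0.
have q_ge0 : forall t, 0 <= t -> orthant (q t) by case: hq.
pose M := lyapunov qs (q 0) + 2 * rho.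
have L0 := lyapunov_ge0 qs (q 0).
have [kappa k0 Dk] := dissipation_uniform M hqs rho0.
pose A := \sum_i rate i; pose C := lambda + \sum_i mu i.
have A0 : 0 <= A by apply: sumr_ge0 => i _; exact/ltW/rate_gt0.
have C0 : 0 <= C by rewrite addr_ge0 ?sumr_ge0 ?ltW// => i _; exact: ltW.
pose om u := lambda * (expR (2 * (A * (C * u))) - 1).
pose h u := (A + M) * om u + 5 * A * C ^+ 2 * u.
have om0 u : 0 <= u -> 0 <= om u.
  by move=> u0; rewrite mulr_ge0 ?(ltW hlambda)// subr_ge0 -expR0 ler_expR !mulr_ge0.
have ch : h u @[u --> (0 : R)] --> h 0.
  apply: cvgD; last by apply: cvgM; [exact: cvg_cst|exact: cvg_id].
  apply: cvgM; first exact: cvg_cst.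
  apply: cvgM; first exact: cvg_cst.
  apply: cvgB; last exact: cvg_cst.
  apply: (@continuous_comp _ _ _ (fun u => 2 * (A * (C * u))) (@expR R));
    last exact: continuous_expR.
  apply: cvgM; first exact: cvg_cst.
  apply: cvgM; first exact: cvg_cst.
  by apply: cvgM; [exact: cvg_cst|exact: cvg_id].
have h0 : h 0 = 0 by rewrite /h /om !mulr0 expR0 subrr !mulr0 addr0.
have [d0 /= d0_gt0 hd0] : \forall u \near (0 : R), `|h 0 - h u| < kappa.
  by move/cvgrPdist_lt : ch; apply.
(* The first bound stays strictly inside the ball where [h] is small; the second limits the gain
   [kappa * u] of a step started below [rho] to [rho]. *)
pose d := Num.min (d0 / 2) (rho / kappa).
have d_gt0 : 0 < d by rewrite lt_min !divr_gt0.
have hd u : 0 <= u <= d -> h u <= kappa.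
  move=> /andP[u0 ud]; have := hd0 u; rewrite /= sub0r normrN h0 sub0r normrN.
  have ud0 : `|u| < d0.
    rewrite ger0_norm// (le_lt_trans ud)// gt_min; apply/orP; left; lra.
  by move=> /(_ ud0) /(le_lt_trans (ler_norm _))/ltW.
have step s u : 0 <= s -> 0 <= u <= d -> lyapunov qs (q s) <= M ->
    lyapunov qs (q (s + u)) <=
    lyapunov qs (q s) + u * (2 * dissipation qs (q s) + kappa).
  move=> s0 ud sM; have /andP[u0 _] := ud.
  apply: (le_trans (lyapunov_step hq hqs s0 u0)); rewrite lerD2l ler_wpM2l//.
  rewrite lerD2l (le_trans _ (hd _ ud))// /h lerD2r ler_wpM2r ?om0//.
  by rewrite lerD2l.
apply: (@grid_decay R (fun t => lyapunov qs (q t)) rho kappa d) => //.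
- move=> s u s0 ud rs sM; apply: (le_trans (step s u s0 ud sM)).
  have Ds := Dk _ (q_ge0 _ s0) rs sM; have /andP[u0 _] := ud.
  have -> : lyapunov qs (q s) - kappa * u = lyapunov qs (q s) + u * - kappa by ring.
  rewrite lerD2l ler_wpM2l//; lra.
- move=> s u s0 ud rs; have /andP[u0 udd] := ud.
  have sM : lyapunov qs (q s) <= M by rewrite /M; lra.
  apply: (le_trans (step s u s0 ud sM)).
  have [Ds _] := dissipation_le0 hqs (q_ge0 _ s0).
  have : u * (2 * dissipation qs (q s) + kappa) <= rho; last lra.
  apply: (@le_trans _ _ (u * kappa)); first by rewrite ler_wpM2l//; lra.
  by rewrite -ler_pdivlMr// (le_trans udd)// ge_min lexx orbT.
Qed.

Lemma trajectory_cvg (q : R -> 'rV[R]_N) qs :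
  reflected_trajectory alpha beta gamma c mu lambda q ->
  equilibrium alpha beta gamma c mu lambda qs ->
  q t @[t --> +oo] --> qs.
Proof.
move=> hq hqs.
have coord (e : R) i : 0 < e -> \forall t \near +oo, `|qs 0 i - q t 0 i| < e.
  move=> e0; have r0 := rate_gt0 i.
  (* With this level the squared error of coordinate [i] is eventually at most [e ^+ 2 / 2],
     strictly below [e ^+ 2]. *)
  have rho0 : 0 < rate i * e ^+ 2 / 4 by rewrite divr_gt0// mulr_gt0// exprn_gt0.
  have [T hT] := lyapunov_decay hq hqs rho0.
  near=> t; have Tt : T <= t by near: t; exact: nbhs_pinfty_ge (num_real T).
  have := le_trans (le_lyapunov qs (q t) i) (hT t Tt).
  have -> : 2 * (rate i * e ^+ 2 / 4) = rate i * (e ^+ 2 / 2) by field.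
  rewrite ler_pM2l// => h; rewrite distrC -ltr_sqr ?nnegrE ?(ltW e0)//.
  rewrite real_normK ?num_real//; have := exprn_gt0 2 e0; lra.
apply/cvg_ballP => e e0.
near=> t; split=> // i j; rewrite ord1.
move: j; near: t; apply: filter_forall => j.
exact: coord.
Unshelve. all: by end_near. Qed.

End uas.

Theorem theorem3p7 (R : realType) (N : nat) (alpha beta gamma c : R)
    (mu : 'I_N -> R) (lambda : R)
    (hN : (1 <= N)%N) (halpha : 0 < alpha) (hbeta : 0 < beta) (hc : 0 <= c)
    (hmu : forall i, 0 < mu i)
    (hlambda : 0 < lambda) (hstable : lambda < \sum_i mu i) :
  exists Kstar : R,
    [/\ unique (fun K => 0 < K /\ balance alpha beta gamma c mu lambda K) Kstar,
        unique (equilibrium alpha beta gamma c mu lambda)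
          (qstar alpha beta gamma c mu Kstar) &
        forall q : R -> 'rV[R]_N,
          reflected_trajectory alpha beta gamma c mu lambda q ->
          q t @[t --> +oo] --> qstar alpha beta gamma c mu Kstar].
Proof.
have [K K0 bK] := balance_exists alpha beta gamma c hmu hlambda hstable.
have eqK := balance_equilibrium halpha hmu hlambda K0 bK.
exists K; split.
- split=> // K' [K'0 bK'].
  exact: (balance_unique hN halpha hmu hlambda hstable K0 K'0 bK bK').
- split=> // q hq.
  exact: (equilibrium_unique hN halpha hmu hlambda hstable eqK hq).
- by move=> q hq; exact: (trajectory_cvg hN halpha hmu hlambda hstable hq eqK).
Qed.
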